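(* Let $K$ be a field of characteristic zero, $S=K[x_1,\dots,x_n]$, and let $I=QS$ be the defining ideal of a central hyperplane arrangement in $K^n$. Then the ring $\mathcal{D}(I)/I\mathcal{D}(S)$ is right Noetherian if and only if $\mathcal{D}(I)/I\mathcal{D}(S)$ is left Noetherian.
   Context: $\mathcal{D}(S)=K[x_1,\dots,x_n]\langle\partial_1,\dots,\partial_n\rangle$ is the $n$-th Weyl algebra, acting on $S$ with $\partial_i=\partial/\partial x_i$. A central arrangement is a finite set $\mathcal{A}=\{H_1,\dots,H_r\}$ of (distinct) hyperplanes in $K^n$ all containing the origin; $p_i$ is a homogeneous polynomial of degree $1$ defining $H_i$, $Q=p_1\cdots p_r$, and $I=QS$ is the defining ideal. For an ideal $J$ of $S$, $\mathcal{D}(J)=\{\theta\in\mathcal{D}(S)\mid\theta(J)\subseteq J\}$, a subring of $\mathcal{D}(S)$, and $J\mathcal{D}(S)$ is a two-sided ideal of $\mathcal{D}(J)$. The quotient ring $\mathcal{D}(I)/I\mathcal{D}(S)$ is isomorphic to the ring $\mathcal{D}(S/I)$ of $K$-linear differential operators of $S/I$ (a known fact). *)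

(* Defs.v *)
From HB Require Import structures.
From mathcomp Require Import all_boot all_order all_algebra.
From mathcomp Require Import boolp mpoly.

Set Implicit Arguments.
Unset Strict Implicit.
Unset Printing Implicit Defensive.

Import GRing.Theory.
Local Open Scope ring_scope.
Local Open Scope quotient_scope.

(* Two-sided ideals, possibly the whole ring.  [idealr] only covers proper
   ideals, and its quotient rings are only available over commutative rings. *)

HB.mixin Record isTwoSided (R : pzRingType) (I : {pred R}) := {
  two_sidedMl : forall a x, x \in I -> a * x \in I;
  two_sidedMr : forall a x, x \in I -> x * a \in I
}.

#[short(type="twoSidedIdeal")]
HB.structure Definition TwoSidedIdeal (R : pzRingType) :=
  {I of GRing.ZmodClosed R I & isTwoSided R I}.

Definition ring_quot (R : pzRingType) (I : twoSidedIdeal R) := Quotient.quot I.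

Section RingQuot.
Variables (R : pzRingType) (I : twoSidedIdeal R).

HB.instance Definition _ := EqQuotient.on (ring_quot I).
HB.instance Definition _ := GRing.Zmodule.on (ring_quot I).

Local Notation Q := (ring_quot I).

Definition quot_one : Q := \pi_Q 1.
Definition quot_mul : Q -> Q -> Q := lift_op2 Q *%R.

Lemma quot_eqE (x y : R) : (x == y %[mod Q]) = (x - y \in I).
Proof. by rewrite -Quotient.idealrBE. Qed.

Lemma quot_mulE (x y : R) : quot_mul (\pi_Q x) (\pi_Q y) = \pi_Q (x * y).
Proof.
rewrite /quot_mul; unlock; set x' := repr _; set y' := repr _.
have hx : x' - x \in I by rewrite -quot_eqE /x' reprK.
have hy : y' - y \in I by rewrite -quot_eqE /y' reprK.
apply/eqP; rewrite quot_eqE.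
have -> : x' * y' - x * y = x' * (y' - y) + (x' - x) * y.
  by rewrite mulrBr mulrBl addrA subrK.
by apply: rpredD; [apply: two_sidedMl | apply: two_sidedMr].
Qed.

Lemma quot_addE (x y : R) : \pi_Q x + \pi_Q y = \pi_Q (x + y).
Proof. exact/esym/Quotient.pi_add. Qed.

Fact quot_mulA : associative quot_mul.
Proof.
elim/quotW=> x; elim/quotW=> y; elim/quotW=> z.
by rewrite !quot_mulE mulrA.
Qed.

Fact quot_mul1r : left_id quot_one quot_mul.
Proof. by elim/quotW=> x; rewrite quot_mulE mul1r. Qed.

Fact quot_mulr1 : right_id quot_one quot_mul.
Proof. by elim/quotW=> x; rewrite quot_mulE mulr1. Qed.

Fact quot_mulDl : left_distributive quot_mul +%R.
Proof.
elim/quotW=> x; elim/quotW=> y; elim/quotW=> z.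
by rewrite !(quot_addE, quot_mulE) mulrDl.
Qed.

Fact quot_mulDr : right_distributive quot_mul +%R.
Proof.
elim/quotW=> x; elim/quotW=> y; elim/quotW=> z.
by rewrite !(quot_addE, quot_mulE) mulrDr.
Qed.

HB.instance Definition _ := GRing.Zmodule_isPzRing.Build (ring_quot I)
  quot_mulA quot_mul1r quot_mulr1 quot_mulDl quot_mulDr.

End RingQuot.

Section Noetherian.
Variable R : pzRingType.
Implicit Type I : R -> Prop.

Definition left_ideal I :=
  [/\ I 0, forall x y, I x -> I y -> I (x + y) & forall a x, I x -> I (a * x)].

Definition right_ideal I :=
  [/\ I 0, forall x y, I x -> I y -> I (x + y) & forall a x, I x -> I (x * a)].

Definition acc_on (P : (R -> Prop) -> Prop) :=
  forall I : nat -> R -> Prop,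
    (forall k, P (I k)) -> (forall k x, I k x -> I k.+1 x) ->
    exists N, forall k, (N <= k)%N -> forall x, I k x <-> I N x.

Definition left_noetherian := acc_on left_ideal.
Definition right_noetherian := acc_on right_ideal.

End Noetherian.

Section PrincipalIdeal.
Variables (R : comPzRingType) (q : R).

Definition principal_ideal : {pred R} := fun p => `[< exists s, p = q * s >].

Lemma principal_idealP p :
  reflect (exists s, p = q * s) (p \in principal_ideal).
Proof. exact: asboolP. Qed.

Fact principal_ideal_zmod : zmod_closed principal_ideal.
Proof.
split=> [|_ _ /principal_idealP[s ->] /principal_idealP[t ->]].
  by apply/principal_idealP; exists 0; rewrite mulr0.
by apply/principal_idealP; exists (s - t); rewrite mulrBr.
Qed.

Fact principal_idealMl a x :
  x \in principal_ideal -> a * x \in principal_ideal.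
Proof.
by move=> /principal_idealP[s ->]; apply/principal_idealP; exists (a * s);
  rewrite mulrCA.
Qed.

Fact principal_idealMr a x :
  x \in principal_ideal -> x * a \in principal_ideal.
Proof. by move=> xI; rewrite mulrC principal_idealMl. Qed.

HB.instance Definition _ :=
  GRing.isZmodClosed.Build R principal_ideal principal_ideal_zmod.
HB.instance Definition _ :=
  isTwoSided.Build R principal_ideal principal_idealMl principal_idealMr.

End PrincipalIdeal.

(* The ring End_K(V), with composition as product; no finiteness assumption on
   V, hence not ['End(V)]. *)

Section Endo.
Variables (K : pzRingType) (V : lmodType K).

Record endo := Endo { endo_fun :> V -> V; endo_linear : linear endo_fun }.

HB.instance Definition _ (f : endo) :=
  GRing.isLinear.Build K V V *:%R (endo_fun f) (endo_linear f).

HB.instance Definition _ := gen_eqMixin endo.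
HB.instance Definition _ := gen_choiceMixin endo.

Lemma endoP (f g : endo) : f =1 g -> f = g.
Proof.
case: f g => [f lf] [g lg] /= /funext efg; rewrite efg in lf *.
by rewrite (Prop_irrelevance lf lg).
Qed.

Fact endo_zero_linear : linear (fun _ : V => 0 : V).
Proof. by move=> a u v; rewrite scaler0 addr0. Qed.

Fact endo_opp_linear (f : endo) : linear (fun v => - f v).
Proof. by move=> a u v; rewrite linearP opprD scalerN. Qed.

Fact endo_add_linear (f g : endo) : linear (fun v => f v + g v).
Proof. by move=> a u v; rewrite !linearP scalerDr addrACA. Qed.

Fact endo_one_linear : linear (fun v : V => v).
Proof. by []. Qed.

Fact endo_mul_linear (f g : endo) : linear (fun v => f (g v)).
Proof. by move=> a u v; rewrite !linearP. Qed.

Definition endo_zero := Endo endo_zero_linear.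
Definition endo_opp f := Endo (endo_opp_linear f).
Definition endo_add f g := Endo (endo_add_linear f g).
Definition endo_one := Endo endo_one_linear.
Definition endo_mul f g := Endo (endo_mul_linear f g).

Fact endo_addA : associative endo_add.
Proof. by move=> f g h; apply: endoP => v /=; rewrite addrA. Qed.

Fact endo_addC : commutative endo_add.
Proof. by move=> f g; apply: endoP => v /=; rewrite addrC. Qed.

Fact endo_add0 : left_id endo_zero endo_add.
Proof. by move=> f; apply: endoP => v /=; rewrite add0r. Qed.

Fact endo_addN : left_inverse endo_zero endo_opp endo_add.
Proof. by move=> f; apply: endoP => v /=; rewrite addNr. Qed.

HB.instance Definition _ :=
  GRing.isZmodule.Build endo endo_addA endo_addC endo_add0 endo_addN.

Fact endo_mulA : associative endo_mul.
Proof. by move=> f g h; apply: endoP. Qed.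

Fact endo_mul1 : left_id endo_one endo_mul.
Proof. by move=> f; apply: endoP. Qed.

Fact endo_mulr1 : right_id endo_one endo_mul.
Proof. by move=> f; apply: endoP. Qed.

Fact endo_mulDl : left_distributive endo_mul endo_add.
Proof. by move=> f g h; apply: endoP. Qed.

Fact endo_mulDr : right_distributive endo_mul endo_add.
Proof. by move=> f g h; apply: endoP => v /=; rewrite linearD. Qed.

HB.instance Definition _ := GRing.Zmodule_isPzRing.Build endo
  endo_mulA endo_mul1 endo_mulr1 endo_mulDl endo_mulDr.

Lemma endo0E v : (0 : endo) v = 0. Proof. by []. Qed.
Lemma endoNE (f : endo) v : (- f) v = - f v. Proof. by []. Qed.
Lemma endoDE (f g : endo) v : (f + g) v = f v + g v. Proof. by []. Qed.
Lemma endo1E v : (1 : endo) v = v. Proof. by []. Qed.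
Lemma endoME (f g : endo) v : (f * g) v = f (g v). Proof. by []. Qed.

Lemma endo_sumE (I : Type) (s : seq I) (F : I -> endo) v :
  (\sum_(i <- s) F i) v = \sum_(i <- s) F i v.
Proof. by elim/big_rec2: _ => [|i x y _ <-]. Qed.

End Endo.

Section WeylAlgebra.
Variables (K : fieldType) (n : nat).
Local Notation S := {mpoly K[n]}.

Fact mul_op_linear (p : S) : linear ( *%R p).
Proof. by move=> a u v; rewrite mulrDr scalerAr. Qed.

Definition mul_op (p : S) : endo S := Endo (mul_op_linear p).
Definition partial_op (i : 'I_n) : endo S := Endo (@mderiv_is_linear n K i).

(* S<d_1, ..., d_n>: the subring of End_K(S) generated by the multiplications
   by elements of S and the partial derivatives. In characteristic zero this is
   the n-th Weyl algebra, whose action on S is faithful. *)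
Inductive weyl_gen : endo S -> Prop :=
  | Weyl_mul_op p : weyl_gen (mul_op p)
  | Weyl_partial_op i : weyl_gen (partial_op i)
  | Weyl_sub f g : weyl_gen f -> weyl_gen g -> weyl_gen (f - g)
  | Weyl_mul f g : weyl_gen f -> weyl_gen g -> weyl_gen (f * g).

Definition weyl_pred : pred (endo S) := fun f => `[< weyl_gen f >].

Lemma weyl_predP f : reflect (weyl_gen f) (f \in weyl_pred).
Proof. exact: asboolP. Qed.

Fact weyl_subring : subring_closed weyl_pred.
Proof.
split=> [|f g /weyl_predP fW /weyl_predP gW|f g /weyl_predP fW /weyl_predP gW].
- apply/weyl_predP; suff -> : 1 = mul_op 1 by apply: Weyl_mul_op.
  by apply: endoP => p /=; rewrite mul1r.
- by apply/weyl_predP/Weyl_sub.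
- by apply/weyl_predP/Weyl_mul.
Qed.

HB.instance Definition _ :=
  GRing.isSubringClosed.Build (endo S) weyl_pred weyl_subring.

Record weyl := Weyl { weyl_op :> endo S; weyl_opP : weyl_op \in weyl_pred }.

HB.instance Definition _ := [isSub for weyl_op].
HB.instance Definition _ := [Choice of weyl by <:].
HB.instance Definition _ :=
  GRing.SubChoice_isSubPzRing.Build (endo S) weyl_pred weyl weyl_subring.

Definition weyl_mul_op (p : S) : weyl :=
  @Weyl (mul_op p) (asboolT (Weyl_mul_op p)).

(* Normal forms: used below to see that [J D(S)] is stable under left
   multiplication by the idealizer of [J]. *)

Definition mderivm_op (m : 'X_{1..n}) : endo S :=
  Endo (@mderivm_is_linear n K m).

Inductive normal_form : endo S -> Prop :=
  | Normal_zero : normal_form 0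
  | Normal_add c m f :
      normal_form f -> normal_form (mul_op c * mderivm_op m + f).

Lemma normal_formD f g : normal_form f -> normal_form g -> normal_form (f + g).
Proof.
move=> fN gN; elim: fN => [|c m h _ IH]; first by rewrite add0r.
by rewrite -addrA; apply: Normal_add.
Qed.

Lemma normal_form_mulop p f : normal_form f -> normal_form (mul_op p * f).
Proof.
elim=> [|c m h _ IH]; first by rewrite mulr0; apply: Normal_zero.
rewrite mulrDr mulrA.
suff -> : mul_op p * mul_op c = mul_op (p * c) by apply: Normal_add.
by apply: endoP => q /=; rewrite mulrA.
Qed.

Lemma normal_form_partial i f : normal_form f -> normal_form (partial_op i * f).
Proof.
elim=> [|c m h _ IH]; first by rewrite mulr0; apply: Normal_zero.
have -> : partial_op i * (mul_op c * mderivm_op m + h) =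
    mul_op (mderiv i c) * mderivm_op m +
    (mul_op c * mderivm_op (m + U_(i)) + partial_op i * h).
  apply: endoP => q; rewrite /= mderivD mderivM addrA.
  by rewrite mderivmDm mderivmU1m.
by do 2!apply: Normal_add.
Qed.

Lemma normal_formN f : normal_form f -> normal_form (- f).
Proof.
move=> /(normal_form_mulop (-1)); congr normal_form.
by apply: endoP => q; rewrite /= mulN1r.
Qed.

Lemma weyl_gen_normal_form f : weyl_gen f -> normal_form f.
Proof.
move=> fW; suff /(_ 1): forall g, normal_form g -> normal_form (f * g).
  rewrite mulr1; apply.
  have -> : 1 = mul_op 1 * mderivm_op 0 + 0.
    by apply: endoP => q; rewrite /= mderivm0m mul1r addr0.
  by apply: Normal_add; apply: Normal_zero.
elim: fW => {f} [p|i|f h _ IHf _ IHh|f h _ IHf _ IHh] g gN.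
- exact: normal_form_mulop.
- exact: normal_form_partial.
- by rewrite mulrBl; apply: normal_formD (normal_formN _); [apply: IHf | apply: IHh].
- by rewrite -mulrA; apply/IHf/IHh.
Qed.

Lemma weyl_gen_mderivm m : weyl_gen (mderivm_op m).
Proof.
have mul1W : weyl_gen 1.
  suff -> : 1 = mul_op 1 by apply: Weyl_mul_op.
  by apply: endoP => p; rewrite /= mul1r.
have iterW i k f : weyl_gen f ->
    exists2 g, weyl_gen g & forall p, g p = iter k (@mderiv n K i) (f p).
  move=> fW; elim: k => [|k [g gW gE]]; first by exists f.
  exists (partial_op i * g); first exact: Weyl_mul (Weyl_partial_op i) gW.
  by move=> p; rewrite /= gE.
suff [f fW fE]: exists2 f, weyl_gen f &
    forall p, f p = foldr (fun i => iter (m i) (@mderiv n K i)) p (enum 'I_n).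
  by suff -> : mderivm_op m = f by []; apply: endoP => p; rewrite fE.
elim: (enum 'I_n) => [|i s [f fW fE]]; first by exists 1.
have [g gW gE] := iterW i (m i) f fW; exists g => // p.
by rewrite gE fE.
Qed.

Definition weyl_mderivm (m : 'X_{1..n}) : weyl :=
  @Weyl (mderivm_op m) (asboolT (weyl_gen_mderivm m)).

Lemma weyl_sum_op (I : Type) (s : seq I) (F : I -> weyl) :
  weyl_op (\sum_(i <- s) F i) = \sum_(i <- s) weyl_op (F i).
Proof. exact: (raddf_sum (val : {additive weyl -> endo S})). Qed.

Lemma normal_form_sum f : normal_form f -> exists (s : seq 'X_{1..n}) c,
  uniq s /\ f = \sum_(m <- s) mul_op (c m) * mderivm_op m.
Proof.
move=> fN; have [t ->] : exists t : seq (S * 'X_{1..n}),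
    f = \sum_(x <- t) mul_op x.1 * mderivm_op x.2.
  elim: fN => [|c m h _ [t ->]]; first by exists [::]; rewrite big_nil.
  by exists ((c, m) :: t); rewrite big_cons.
exists (undup (map snd t)), (fun m => \sum_(x <- t | x.2 == m) x.1).
split; first exact: undup_uniq.
apply: endoP => p; rewrite !endo_sumE /=.
under [RHS]eq_bigr => m _ do rewrite mulr_suml.
rewrite (exchange_big_dep xpredT) //=; apply: eq_big_seq => x xt.
have x2u : x.2 \in undup (map snd t) by rewrite mem_undup map_f.
rewrite big_mkcond (bigD1_seq x.2) ?undup_uniq //= eqxx big1 ?addr0 // => m.
by rewrite eq_sym => /negbTE ->.
Qed.

Lemma mderivm_eq0 (m : 'X_{1..n}) : (\prod_(i < n) (m i)`!)%:R = 0 :> K ->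
  mderivm_op m = 0.
Proof.
move=> m0; apply: endoP => p; rewrite /= mderivmE big1 // => m' _.
have -> : (\prod_(i < n) (m' i) ^_ (m i) =
    (\prod_(i < n) 'C(m' i, m i)) * \prod_(i < n) (m i)`!)%N.
  by rewrite -big_split; apply: eq_bigr => i _; rewrite /= bin_ffact.
by rewrite natrM m0 !mulr0 scale0r.
Qed.

End WeylAlgebra.

Section Idealizer.
Variables (K : fieldType) (n : nat).
Local Notation S := {mpoly K[n]}.
Variable J : twoSidedIdeal S.
Implicit Types f g : weyl K n.

(* [J D(S)], as a subset of D(S). *)
Definition in_ideal_weyl (f : weyl K n) : Prop :=
  exists s : seq (S * weyl K n),
    all (fun x => x.1 \in J) s /\
    f = \sum_(x <- s) weyl_mul_op x.1 * x.2.

Definition idealizer_pred : pred (weyl K n) :=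
  fun f => `[< forall p, p \in J -> f p \in J >].

Lemma idealizerP f :
  reflect (forall p, p \in J -> f p \in J)
    (f \in idealizer_pred).
Proof. exact: asboolP. Qed.

Fact idealizer_subring : subring_closed idealizer_pred.
Proof.
split=> [|f g /idealizerP fJ /idealizerP gJ|f g /idealizerP fJ /idealizerP gJ];
  apply/idealizerP => p pJ //.
- by rewrite rpredB ?fJ ?gJ.
- by rewrite fJ ?gJ.
Qed.

HB.instance Definition _ :=
  GRing.isSubringClosed.Build (weyl K n) idealizer_pred idealizer_subring.

Record idealizer :=
  Idealizer { idealizer_op :> weyl K n; _ : idealizer_op \in idealizer_pred }.

HB.instance Definition _ := [isSub for idealizer_op].
HB.instance Definition _ := [Choice of idealizer by <:].
HB.instance Definition _ := GRing.SubChoice_isSubPzRing.Build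
  (weyl K n) idealizer_pred idealizer idealizer_subring.

Lemma ideal_weyl_im f p : in_ideal_weyl f -> f p \in J.
Proof.
case=> s [/allP sJ ->]; rewrite weyl_sum_op endo_sumE big_seq rpred_sum //.
by move=> x xs; apply: two_sidedMr; apply: sJ.
Qed.

Lemma ideal_weyl_idealizer f : in_ideal_weyl f -> f \in idealizer_pred.
Proof. by move=> fJ; apply/idealizerP => p _; apply: ideal_weyl_im. Qed.

Lemma ideal_weylP f :
  in_ideal_weyl f <-> forall p, f p \in J.
Proof.
split=> [fJ p|]; first exact: ideal_weyl_im.
case: f => f fW /= fJ.
have /normal_form_sum[s [c [s_uniq fE]]] :=
  weyl_gen_normal_form (weyl_predP _ fW).
pose nz (m : 'X_{1..n}) := (\prod_(i < n) (m i)`!)%:R != 0 :> K.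
have cJ d m : (mdeg m < d)%N -> m \in s -> nz m -> c m \in J.
  elim: d m => // d IH m md ms mnz.
  have := fJ 'X_[m]; rewrite fE endo_sumE (bigD1_seq m) //=.
  rewrite rpredDr; last first.
    rewrite big_seq_cond rpred_sum // => m' /andP[m's m'm].
    have [m'nz|] := boolP (nz m'); last first.
      move=> /negPn/eqP/mderivm_eq0 m'0.
      have -> : 'X_[m]^`M[m'] = mderivm_op K m' 'X_[m] by [].
      by rewrite m'0 endo0E mulr0 rpred0.
    have [le_m'm|nle_m'm] := boolP (m' <= m)%MM.
      apply: two_sidedMr; apply: IH => //.
      apply: leq_trans (md : (mdeg m <= d)%N).
      rewrite -(submK le_m'm) mdegD.
      rewrite -[X in (X < _)%N]add0n ltn_add2r lt0n mdeg_eq0.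
      apply: contra m'm => /eqP mm'0.
      by rewrite -(submK le_m'm) mm'0 add0m.
    suff -> : 'X_[m]^`M[m'] = 0 :> S by rewrite mulr0 rpred0.
    move: nle_m'm; rewrite negb_forall => /existsP[i].
    rewrite -ltnNge => lt_i.
    by rewrite mderivmX (bigD1 i) //= ffact_small // mul0n scale0r.
  rewrite mderivmX; under eq_bigr => i _ do rewrite ffactnn.
  have -> : (m - m = 0)%MM by apply/mnmP => i; rewrite mnmBE subnn mnm0E.
  rewrite mpolyX0 -scalerAr mulr1 => cmJ.
  have -> : c m = (\prod_(i < n) (m i)`!)%:R^-1%:MP *
      ((\prod_(i < n) (m i)`!)%:R *: c m).
    by rewrite mul_mpolyC scalerA mulVf // scale1r.
  exact: two_sidedMl.
pose t := [seq (c m, weyl_mderivm K m) | m <- s & nz m].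
exists t; split.
  rewrite all_map; apply/allP => m; rewrite mem_filter => /andP[mnz ms].
  exact: (cJ (mdeg m).+1).
apply: val_inj; rewrite /= fE weyl_sum_op /t big_map big_filter /=.
rewrite [RHS]big_mkcond; apply: eq_bigr => m _.
by case: ifPn => // /negPn/eqP/mderivm_eq0 ->; rewrite mulr0.
Qed.

Lemma ideal_weylMl f g :
  f \in idealizer_pred -> in_ideal_weyl g -> in_ideal_weyl (f * g).
Proof.
by move=> /idealizerP fJ /ideal_weylP gJ; apply/ideal_weylP => p; apply: fJ.
Qed.

Lemma ideal_weylMr f g : in_ideal_weyl f -> in_ideal_weyl (f * g).
Proof. by move=> /ideal_weylP fJ; apply/ideal_weylP => p; apply: fJ. Qed.

(* [J D(S)], as a subset of D(J), in which it is contained by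
   [ideal_weyl_idealizer]. *)
Definition ideal_weyl : {pred idealizer} :=
  fun f : idealizer => `[< in_ideal_weyl f >].

Fact ideal_weyl_zmod : zmod_closed ideal_weyl.
Proof.
split=> [|f g /asboolP/ideal_weylP fJ /asboolP/ideal_weylP gJ];
  apply/asboolP/ideal_weylP => p; first exact: rpred0.
by apply: rpredB; [apply: fJ | apply: gJ].
Qed.

Fact ideal_weyl_mull (a f : idealizer) : f \in ideal_weyl -> a * f \in ideal_weyl.
Proof.
by move=> /asboolP fJ; apply/asboolP; apply: ideal_weylMl (valP a) fJ.
Qed.

Fact ideal_weyl_mulr (a f : idealizer) : f \in ideal_weyl -> f * a \in ideal_weyl.
Proof. by move=> /asboolP fJ; apply/asboolP; apply: ideal_weylMr fJ. Qed.

HB.instance Definition _ :=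
  GRing.isZmodClosed.Build idealizer ideal_weyl ideal_weyl_zmod.
HB.instance Definition _ :=
  isTwoSided.Build idealizer ideal_weyl ideal_weyl_mull ideal_weyl_mulr.

(* D(J) / J D(S) *)
Definition diffop_quot : pzRingType := ring_quot ideal_weyl.

End Idealizer.

Section Arrangement.
Variables (K : fieldType) (n r : nat).

(* Hyperplanes of K^n through the origin are the linear subspaces of
   codimension 1. *)
Definition central_arrangement (H : 'I_r -> {vspace 'rV[K]_n}) : Prop :=
  injective H /\ forall i, (\dim (H i)).+1 = n.

Definition defines_hyperplane (p : {mpoly K[n]}) (H : {vspace 'rV[K]_n}) :=
  p \is 1.-homog /\ forall v : 'rV[K]_n, (v \in H) = (p.@[v 0] == 0).

End Arrangement.

(* Main.v *)
From HB Require Import structures.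
Require Import Defs.
From mathcomp Require Import all_boot all_order all_algebra.
From mathcomp Require Import boolp ssrcomplements mpoly.

(** The ring D(I)/ID(S) is isomorphic to its own opposite as soon as I = QS
    with Q nonzero, so left and right ideals play the same role in it.

    The idea is classical: an anti-automorphism t of D(S) that fixes Q sends
    D(I) = D(S) /\ Q D(S) Q^-1 to D(S) /\ Q^-1 D(S) Q, which conjugation by Q
    brings back to D(I); so f |-> Q t(f) Q^-1 is an anti-automorphism of D(I),
    and it maps Q D(S) to Q D(S) Q Q^-1 = Q D(S).  To conjugate without a
    field of fractions, write f Q = Q phi with phi in D(S); then
    Q t(f) Q^-1 = t(phi).

    The usual choice for t is x_i |-> x_i, d_i |-> - d_i.  Operators are given
    here as endomorphisms of S, and that t is not visibly well defined on
    endomorphisms.  The one used instead is x_i |-> x_i, d_i |-> x_i - d_i,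
    which is the passage to adjoints for the pairing (p, q) |-> L(p q), where
    L is the expectation of a polynomial in independent standard Gaussian
    variables: L(d_i p) = L(x_i p) is Gaussian integration by parts
    ([gaussian_by_parts]).  Since the moments of L are integers, L makes sense
    over any field.  In characteristic zero the pairing is nondegenerate
    ([gaussian_nondegenerate]), because its radical is a D(S)-submodule of S:
    if it were nonzero it would contain a nonzero constant c, whereas
    L(c) = c.  So adjoints are unique, and they exist in D(S) since they exist
    for its generators ([weyl_adjoint]).

    In terms of L, the operators f and f' = Q t(f) Q^-1 are adjoint for the
    pairing (Q p, Q q) |-> L(Q p q) on I: this says that
    L(f(Q p) q) = L(p f'(Q q)) for all p and q.  The relation is symmetric,
    hence [idealizer_star] is even an involution. *)

Set Implicit Arguments.
Unset Strict Implicit.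
Unset Printing Implicit Defensive.

Import GRing.Theory.
Local Open Scope ring_scope.
Local Open Scope quotient_scope.

(** * Rings with an anti-involution *)

Definition anti_involution (R : pzRingType) (s : R -> R) :=
  [/\ {morph s : x y / x + y}, {morph s : x y / x * y >-> y * x}
    & involutive s].

Section AntiInvolution.
Variables (R : pzRingType) (s : R -> R).
Hypothesis s_anti : anti_involution s.

Lemma anti_involution0 : s 0 = 0.
Proof.
have [sD _ _] := s_anti.
by apply: (addrI (s 0)); rewrite -sD !addr0.
Qed.

Lemma anti_involutionB x y : s (x - y) = s x - s y.
Proof.
have [sD _ _] := s_anti.
by apply: (addIr (s y)); rewrite -sD !subrK.
Qed.

Lemma right_ideal_preim I : left_ideal I -> right_ideal (fun x => I (s x)).
Proof.
have [sD sM _] := s_anti; case=> I0 ID IM; split.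
- by rewrite anti_involution0.
- by move=> x y Ix Iy; rewrite sD; apply: ID.
- by move=> a x Ix; rewrite sM; apply: IM.
Qed.

Lemma left_ideal_preim I : right_ideal I -> left_ideal (fun x => I (s x)).
Proof.
have [sD sM _] := s_anti; case=> I0 ID IM; split.
- by rewrite anti_involution0.
- by move=> x y Ix Iy; rewrite sD; apply: ID.
- by move=> a x Ix; rewrite sM; apply: IM.
Qed.

Lemma acc_on_preim (P P' : (R -> Prop) -> Prop) :
  (forall I, P I -> P' (fun x => I (s x))) -> acc_on P' -> acc_on P.
Proof.
have [_ _ sK] := s_anti; move=> PP' acc I IP Iincr.
have [k|k x|N NE] := acc (fun k x => I k (s x)); [exact/PP'/IP|exact: Iincr|].
by exists N => k Nk x; rewrite -[x]sK; apply: NE.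
Qed.

Lemma right_noetherian_iff_left : right_noetherian R <-> left_noetherian R.
Proof.
split; apply: acc_on_preim.
- exact: right_ideal_preim.
- exact: left_ideal_preim.
Qed.

Variable I : twoSidedIdeal R.
Hypothesis sI : forall x, x \in I -> s x \in I.

Definition quot_anti (x : ring_quot I) : ring_quot I :=
  \pi_(ring_quot I) (s (repr x)).

Lemma quot_anti_pi x :
  quot_anti (\pi_(ring_quot I) x) = \pi_(ring_quot I) (s x).
Proof.
apply/eqP; rewrite quot_eqE -anti_involutionB; apply: sI.
by rewrite -quot_eqE reprK.
Qed.

Lemma quot_anti_involution : anti_involution quot_anti.
Proof.
have [sD sM sK] := s_anti; split.
- elim/quotW=> x; elim/quotW=> y.
  by rewrite quot_addE !quot_anti_pi sD quot_addE.
- elim/quotW=> x; elim/quotW=> y.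
  by rewrite /GRing.mul /= quot_mulE !quot_anti_pi sM quot_mulE.
- by move=> x; elim/quotW: x => x; rewrite (quot_anti_pi x) quot_anti_pi sK.
Qed.

End AntiInvolution.

(** * Gaussian expectation of polynomials *)

Fixpoint gaussian_moment (k : nat) : nat :=
  match k with
  | 0 => 1
  | 1 => 0
  | (j.+1 as j1).+1 => j1 * gaussian_moment j
  end%N.

Section Gaussian.
Variables (K : fieldType) (n : nat).
Local Notation S := {mpoly K[n]}.
Implicit Types (p q : S) (m : 'X_{1..n}) (f g : endo S).

Definition gaussian_mmoment m : K := (\prod_(i < n) gaussian_moment (m i))%:R.

Definition gaussian p : K := \sum_(m <- msupp p) p@_m * gaussian_mmoment m.

Lemma gaussianwE k p : (msize p <= k)%N ->
  gaussian p = \sum_(m : 'X_{1..n < k}) p@_m * gaussian_mmoment m.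
Proof.
pose I : subFinType _ := 'X_{1..n < k}.
move=> le_pk; rewrite /gaussian (big_mksub I) /=; first last.
- by move=> x /msize_mdeg_lt/leq_trans/(_ le_pk).
- by rewrite msupp_uniq.
by rewrite big_rmcond //= => j /memN_msupp_eq0 ->; rewrite mul0r.
Qed.

Lemma gaussian_is_linear : linear_for *%R gaussian.
Proof.
move=> c p q.
pose k := maxn (msize (c *: p + q)) (maxn (msize p) (msize q)).
rewrite (@gaussianwE k (c *: p + q)) ?leq_maxl //.
rewrite (@gaussianwE k p) ?(@gaussianwE k q) ?leq_max ?leqnn ?orbT //.
rewrite mulr_sumr -big_split; apply: eq_bigr => m _.
by rewrite mcoeffD mcoeffZ mulrDl mulrA.
Qed.

HB.instance Definition _ := GRing.isLinear.Build K S K *%R gaussian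
  gaussian_is_linear.

Lemma gaussianX m : gaussian 'X_[m] = gaussian_mmoment m.
Proof. by rewrite /gaussian msuppX big_seq1 mcoeffX eqxx mul1r. Qed.

Lemma gaussianC c : gaussian c%:MP = c.
Proof.
rewrite -[c%:MP]mulr1 mul_mpolyC linearZ /= -mpolyX0 gaussianX.
rewrite /gaussian_mmoment big1 ?mulr1 // => i _.
by rewrite mnm0E.
Qed.

(** On monomials this is the recursion E[x^(k+1)] = k E[x^(k-1)] that defines
    the moments. *)
Lemma gaussian_by_parts i p : gaussian p^`M(i) = gaussian ('X_i * p).
Proof.
elim/mpolyind: p => [|c m p _ _ IH]; first by rewrite mulr0 mderiv0.
rewrite mderivD mderivZ mulrDr -scalerAr !linearD /= IH !linearZ /=.
congr (_ * _ + _); rewrite mderivX linearZ /= -mpolyXD !gaussianX.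
rewrite /gaussian_mmoment (bigD1 i) //= [in RHS](bigD1 i) //= !natrM mulrA -(natrM _ (m i)).
rewrite mnmBE mnmDE mnm1E eqxx add1n subn1; congr (_%:R * _%:R).
  by case: (m i) => // k.
apply: eq_bigr => j ji; rewrite mnmBE mnmDE mnm1E eq_sym (negbTE ji).
by rewrite subn0 add0n.
Qed.

(** * Adjoints of differential operators *)

Definition adjoint f g := forall p q, gaussian (f p * q) = gaussian (p * g q).

Lemma weyl_adjoint f : weyl_gen f -> exists2 g, weyl_gen g & adjoint f g.
Proof.
elim=> {f} [r|i|f h _ [f' f'W fE] _ [h' h'W hE]|f h _ [f' f'W fE] _ [h' h'W hE]].
- exists (mul_op r); first exact: Weyl_mul_op.
  by move=> p q; rewrite /= mulrCA mulrA.
- exists (mul_op 'X_i - partial_op K i).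
    by apply: Weyl_sub; [apply: Weyl_mul_op | apply: Weyl_partial_op].
  move=> p q; rewrite endoDE endoNE /= mulrBr linearB mulrCA.
  by rewrite /= -gaussian_by_parts mderivM linearD addrK.
- exists (f' - h'); first exact: Weyl_sub.
  by move=> p q; rewrite !endoDE !endoNE mulrBr mulrBl !linearB /= fE hE.
- exists (h' * f'); first exact: Weyl_mul.
  by move=> p q; rewrite !endoME fE hE.
Qed.

Hypothesis charK : [pchar K] =i pred0.

(** If m is the leading monomial of a nonzero p in the radical of the pairing,
    then d^m p is a nonzero constant, which lies in the radical too since d^m
    has an adjoint. *)
Lemma gaussian_nondegenerate p : (forall q, gaussian (p * q) = 0) -> p = 0.
Proof.
move=> p_rad; apply/eqP/negPn/negP => p_neq0.
pose m := mlead p.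
have [g _ gE] := weyl_adjoint (@weyl_gen_mderivm K n m).
have pmE : p^`M[m] = (p^`M[m]@_0)%:MP.
  apply/mpolyP => m'; rewrite mcoeffC; have [->|m'_neq0] := eqVneq m' 0%MM.
    by rewrite mulr1.
  rewrite mulr0 mcoeff_mderivm memN_msupp_eq0 ?mul0rn //.
  apply/msize_mdeg_ge; rewrite -(mlead_deg p_neq0) mdegD.
  by rewrite -[X in (X < _)%N]addn0 ltn_add2l lt0n mdeg_eq0.
have : p^`M[m]@_0 = 0.
  rewrite -[LHS]gaussianC -pmE -[p^`M[m]]mulr1.
  by rewrite [LHS](gE p 1) p_rad.
apply/eqP; rewrite mcoeff_mderivm addm0 -mulr_natr mulf_neq0 //.
  by rewrite mleadc_eq0.
rewrite (pcharf0P K).1 // -lt0n prodn_gt0 // => i.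
by rewrite ffact_gt0.
Qed.

Lemma gaussian_inj q q' :
  (forall p, gaussian (p * q) = gaussian (p * q')) -> q = q'.
Proof.
move=> qq'; apply/eqP; rewrite -subr_eq0; apply/eqP/gaussian_nondegenerate.
by move=> p; rewrite mulrC mulrBr linearB /= qq' subrr.
Qed.

(** * The anti-involution of the idealizer *)

Variable Q : S.
Hypothesis Q_neq0 : Q != 0.
Local Notation J := (principal_ideal Q).

(** Right cancellation of Q in the Weyl algebra.  Taking adjoints turns it
    into left cancellation, which holds because S is a domain. *)
Lemma weyl_eq0_principal f :
  weyl_gen f -> (forall p, f (Q * p) = 0) -> forall p, f p = 0.
Proof.
move=> /weyl_adjoint[g _ fg] fQ p.
have g0 q : g q = 0.
  apply: (mulfI Q_neq0); rewrite mulr0.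
  by apply: gaussian_inj => p'; rewrite mulrCA mulrA -fg fQ mul0r mulr0.
by apply: gaussian_nondegenerate => q; rewrite fg g0 mulr0 linear0.
Qed.

Lemma weyl_factor f : weyl_gen f -> (forall p, f p \in J) ->
  exists2 g, weyl_gen g & forall p, f p = Q * g p.
Proof.
move=> fW fJ.
have /ideal_weylP[s [/allP sJ fE]] :
    forall p, Weyl (introT (weyl_predP f) fW) p \in J by [].
have {sJ} : exists2 g : weyl K n, weyl_gen g &
    \sum_(x <- s) weyl_mul_op x.1 * x.2 = weyl_mul_op Q * g.
  elim: s sJ {fE} => [|x s IH] sJ.
    exists 0; last by rewrite big_nil mulr0.
    exact/weyl_predP/weyl_opP.
  have [|g gW gE] := IH; first by move=> y ys; apply: sJ; rewrite inE ys orbT.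
  have /principal_idealP[c cE] := sJ x (mem_head _ _).
  exists (weyl_mul_op c * x.2 + g); first exact/weyl_predP/weyl_opP.
  rewrite big_cons gE mulrDr mulrA; congr (_ * _ + _).
  by apply: val_inj; apply: endoP => p; rewrite /= cE mulrA.
case=> g gW gE; exists g => // p.
by have /(congr1 (fun h : weyl K n => h p)) := etrans fE gE.
Qed.

(** That f and f' are adjoint for the pairing (Q p, Q q) |-> L(Q p q) on the
    ideal generated by Q, when both preserve this ideal. *)
Definition ideal_adjoint f f' :=
  forall p q, gaussian (f (Q * p) * q) = gaussian (p * f' (Q * q)).

Lemma ideal_adjointC f f' : ideal_adjoint f f' -> ideal_adjoint f' f.
Proof. by move=> ff' p q; rewrite mulrC -ff' mulrC. Qed.

Lemma ideal_adjoint_uniq (f : endo S) (f' f'' : weyl K n) :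
  ideal_adjoint f f' -> ideal_adjoint f f'' -> f' = f''.
Proof.
move=> ff' ff''; apply: val_inj; apply: endoP => p; apply/eqP.
rewrite -subr_eq0; apply/eqP.
apply: (@weyl_eq0_principal (weyl_op f' - weyl_op f'')) => [|q].
  by apply: Weyl_sub; apply/weyl_predP/weyl_opP.
rewrite endoDE endoNE; apply: gaussian_nondegenerate => r.
by rewrite mulrC mulrBr linearB /= -ff' -ff'' subrr.
Qed.

Lemma ideal_adjointD f f' g g' : ideal_adjoint f f' -> ideal_adjoint g g' ->
  ideal_adjoint (f + g) (f' + g').
Proof.
by move=> ff' gg' p q; rewrite !endoDE mulrDl mulrDr !linearD /= ff' gg'.
Qed.

Lemma ideal_adjointM f f' g g' :
    (forall p, p \in J -> g p \in J) -> (forall p, p \in J -> f' p \in J) ->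
    ideal_adjoint f f' -> ideal_adjoint g g' ->
  ideal_adjoint (f * g) (g' * f').
Proof.
move=> gJ f'J ff' gg' p q; rewrite !endoME.
have memJ r : Q * r \in J by apply/principal_idealP; exists r.
have /principal_idealP[s sE] := gJ _ (memJ p).
have /principal_idealP[t tE] := f'J _ (memJ q).
by rewrite sE ff' tE -gg' sE mulrCA mulrA.
Qed.

(** With f Q = Q phi, the operator wanted is the adjoint of phi; it preserves
    the ideal because its composite with Q is Q times the adjoint of f. *)
Lemma ideal_adjoint_exists (f : idealizer J) :
  exists f' : idealizer J, ideal_adjoint f f'.
Proof.
have fW : weyl_gen f by apply/weyl_predP/weyl_opP.
have /idealizerP fJ := valP f.
have [g _ fg] := weyl_adjoint fW.
have [p|phi phiW phiE] := weyl_factor (Weyl_mul fW (Weyl_mul_op Q)).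
  by apply: fJ; apply/principal_idealP; exists p.
have [f' f'W phif'] := weyl_adjoint phiW.
have ff' : ideal_adjoint f f'.
  move=> p q; rewrite -phif' mulrA [_ * Q]mulrC; congr (gaussian (_ * _)).
  exact: phiE.
have f'J : Weyl (introT (weyl_predP f') f'W) \in idealizer_pred J.
  apply/idealizerP => _ /principal_idealP[q ->]; apply/principal_idealP.
  exists (g q); apply: gaussian_inj => p.
  by rewrite -ff' [LHS](fg (Q * p) q) mulrCA mulrA.
by exists (Idealizer f'J).
Qed.

Definition idealizer_star (f : idealizer J) : idealizer J :=
  sval (cid (ideal_adjoint_exists f)).

Lemma idealizer_starP (f : idealizer J) : ideal_adjoint f (idealizer_star f).
Proof. exact: svalP (cid (ideal_adjoint_exists f)). Qed.

Lemma idealizer_star_uniq (f f' : idealizer J) :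
  ideal_adjoint f f' -> idealizer_star f = f'.
Proof.
by move=> ff'; apply: val_inj; apply: ideal_adjoint_uniq ff';
  apply: idealizer_starP.
Qed.

Lemma idealizer_star_anti : anti_involution idealizer_star.
Proof.
have memJ (h : idealizer J) : forall p, p \in J -> h p \in J.
  exact/idealizerP/valP.
split=> [f g|f g|f]; apply: idealizer_star_uniq.
- exact: (ideal_adjointD (idealizer_starP f) (idealizer_starP g)).
- apply: (ideal_adjointM (memJ g) (memJ (idealizer_star f))).
  + exact: idealizer_starP.
  + exact: idealizer_starP.
- exact/ideal_adjointC/idealizer_starP.
Qed.

(** The image of Q psi is Q times the adjoint of psi. *)
Lemma idealizer_star_ideal (f : idealizer J) :
  f \in ideal_weyl (J := J) -> idealizer_star f \in ideal_weyl (J := J).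
Proof.
move=> /asboolP/ideal_weylP fJ; apply/asboolP/ideal_weylP => p.
have [|psi psiW psiE] := weyl_factor _ fJ; first exact/weyl_predP/weyl_opP.
have [g gW psig] := weyl_adjoint psiW.
have QgW : weyl_gen (mul_op Q * g) by apply: Weyl_mul (Weyl_mul_op _) gW.
have fQg : ideal_adjoint f (Weyl (introT (weyl_predP _) QgW)).
  move=> r q; rewrite psiE [RHS]/= [r * _]mulrCA mulrA -psig.
  by rewrite mulrAC mulrC.
rewrite (ideal_adjoint_uniq (idealizer_starP f) fQg).
by apply/principal_idealP; exists (g p).
Qed.

Theorem diffop_quot_right_noetherian_iff_left :
  right_noetherian (diffop_quot J) <-> left_noetherian (diffop_quot J).
Proof.
exact: right_noetherian_iff_left
  (quot_anti_involution idealizer_star_anti idealizer_star_ideal).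
Qed.

End Gaussian.

(** * Central arrangements *)

Lemma defines_hyperplane_neq0 (K : fieldType) (n : nat)
    (H : {vspace 'rV[K]_n}) (p : {mpoly K[n]}) :
  (\dim H).+1 = n -> defines_hyperplane p H -> p != 0.
Proof.
move=> dimH [_ pH]; apply/eqP => p0.
have HT : H = fullv.
  by apply/vspaceP => v; rewrite memvf pH p0 meval0 eqxx.
by move: dimH; rewrite HT dimvf /dim /= mul1n => /esym/n_Sn.
Qed.

Theorem corollary3p3 (K : fieldType) (charK : [pchar K] =i pred0) (n r : nat)
    (H : 'I_r -> {vspace 'rV[K]_n}) (p : 'I_r -> {mpoly K[n]})
    (arrH : central_arrangement H)
    (defH : forall i, defines_hyperplane (p i) (H i)) :
  right_noetherian (diffop_quot (principal_ideal (\prod_(i < r) p i))) <->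
  left_noetherian (diffop_quot (principal_ideal (\prod_(i < r) p i))).
Proof.
apply: diffop_quot_right_noetherian_iff_left => //.
apply/prodf_neq0 => i _; have [_ dimH] := arrH.
exact: defines_hyperplane_neq0 (dimH i) (defH i).
Qed.
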